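(* For each $n\ge 3$, $$PI_n = IA_n\cap (E\Pi A_n)'.$$
   Context: $F_n$ is the free group with free basis $x_1,\dots,x_n$. A palindrome is a reduced word in $x_1^{\pm1},\dots,x_n^{\pm1}$ that equals its reverse word (same letters, with their exponents, read in the opposite order). $\Pi A_n\le \mathrm{Aut}(F_n)$ is the palindromic automorphism group, consisting of all automorphisms of $F_n$ that map each $x_i$ to a palindrome. For $i\ne j$, $\mu_{ij}$ is the automorphism with $x_i\mapsto x_jx_ix_j$ and $x_k\mapsto x_k$ for $k\neq i$, and $E\Pi A_n=\langle \mu_{ij}\mid 1\le i\ne j\le n\rangle$ is the elementary palindromic automorphism group. $IA_n$ is the group of automorphisms of $F_n$ acting trivially on the abelianization of $F_n$. The palindromic Torelli group is $PI_n=IA_n\cap \Pi A_n$. $G'$ denotes the commutator subgroup of $G$. *)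

(* Defs.v *)
From HB Require Import structures.
From mathcomp Require Import all_boot.
From mathcomp Require Import boolp classical_sets.

Set Implicit Arguments.
Unset Strict Implicit.
Unset Printing Implicit Defensive.

Local Open Scope classical_set_scope.
Local Open Scope group_scope.

(* The letter (t, false) stands for the generator t, and (t, true) for its
   formal inverse. *)
Section Words.
Variable T : eqType.
Implicit Types (a b : T * bool) (u v w : seq (T * bool)).

Definition inv_letter a : T * bool := (a.1, ~~ a.2).

Definition reduced w : bool := sorted (fun a b => b != inv_letter a) w.

Definition cons_letter a w :=
  if w is b :: w' then if b == inv_letter a then w' else a :: w else [:: a].

(* If v is reduced, reduce_cat u v is the free reduction of u ++ v. *)
Definition reduce_cat u v := foldr cons_letter v u.

Definition inv_word u := rev (map inv_letter u).

Lemma inv_letterK : involutive inv_letter.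
Proof. by case=> t e; rewrite /inv_letter /= negbK. Qed.

Lemma inv_letter_neq a : (a == inv_letter a) = false.
Proof. by case: a => t [] /=; apply/eqP => -[]. Qed.

Lemma reduced_tail a w : reduced (a :: w) -> reduced w.
Proof. by case: w => // b w /= /andP[]. Qed.

Lemma cons_letter_reduced a w : reduced w -> reduced (cons_letter a w).
Proof.
case: w => // b w /=; case: ifPn => [_|ba] H; first exact: (@reduced_tail b).
by rewrite /= ba.
Qed.

Lemma reduce_cat_reduced u v : reduced v -> reduced (reduce_cat u v).
Proof. by move=> rv; elim: u => //= a u; apply: cons_letter_reduced. Qed.

Lemma cons_letter_id a w : reduced (a :: w) -> cons_letter a w = a :: w.
Proof. by case: w => // b w /= /andP[/negbTE ->]. Qed.

Lemma cons_letterK a w :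
  reduced w -> cons_letter (inv_letter a) (cons_letter a w) = w.
Proof.
case: w => [|b w] /=; first by rewrite inv_letterK eqxx.
case: ifPn => [/eqP -> rw|ba rw]; first exact: cons_letter_id.
by rewrite /= inv_letterK eqxx.
Qed.

Lemma cons_letterVK a w :
  reduced w -> cons_letter a (cons_letter (inv_letter a) w) = w.
Proof. by move=> rw; rewrite -{1}(inv_letterK a) cons_letterK. Qed.

Lemma reduce_cat_rcons a u v : reduced v ->
  reduce_cat (cons_letter a u) v = cons_letter a (reduce_cat u v).
Proof.
move=> rv; case: u => //= b u; case: ifP => //= /eqP ->.
by rewrite cons_letterVK // reduce_cat_reduced.
Qed.

Lemma reduce_catA u v w : reduced v -> reduced w ->
  reduce_cat u (reduce_cat v w) = reduce_cat (reduce_cat u v) w.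
Proof.
move=> rv rw; elim: u => //= a u IHu.
by rewrite reduce_cat_rcons // IHu.
Qed.

Lemma reduce_cat0 u : reduced u -> reduce_cat u [::] = u.
Proof.
elim: u => //= a u IHu ru.
by rewrite (IHu (reduced_tail ru)) cons_letter_id.
Qed.

Lemma reduce_catVw u : reduced u -> reduce_cat (inv_word u) u = [::].
Proof.
rewrite /inv_word; elim: u => //= a u IHu ru.
have ru' := reduced_tail ru.
rewrite rev_cons -cats1 /reduce_cat foldr_cat /=.
by rewrite inv_letterK eqxx; apply: IHu.
Qed.

Lemma inv_wordK : involutive inv_word.
Proof.
move=> u; rewrite /inv_word map_rev revK -map_comp map_id_in // => a _ /=.
exact: inv_letterK.
Qed.

Lemma inv_word_reduced u : reduced u -> reduced (inv_word u).
Proof.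
rewrite /reduced /inv_word rev_sorted sorted_map.
apply: sub_sorted => a b /=; rewrite inv_letterK /relpre /=.
by apply: contra => /eqP ->.
Qed.

End Words.

Record freeGroup (T : choiceType) :=
  FreeGroup { word :> seq (T * bool); word_reduced : reduced word }.

Section FreeGroup.
Variable T : choiceType.

HB.instance Definition _ := [isSub for @word T].
HB.instance Definition _ := [Choice of freeGroup T by <:].

Implicit Types u v w : freeGroup T.

Definition fg_one : freeGroup T := @FreeGroup T [::] isT.
Definition fg_mul u v : freeGroup T :=
  FreeGroup (reduce_cat_reduced u (word_reduced v)).
Definition fg_inv u : freeGroup T :=
  FreeGroup (inv_word_reduced (word_reduced u)).

Lemma fg_mulA : associative fg_mul.
Proof. by move=> u v w; apply/val_inj/reduce_catA; apply: word_reduced. Qed.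

Lemma fg_mul1 : left_id fg_one fg_mul.
Proof. by move=> u; apply/val_inj. Qed.

Lemma fg_mulr1 : right_id fg_one fg_mul.
Proof. by move=> u; apply/val_inj/reduce_cat0/word_reduced. Qed.

Lemma fg_mulV : left_inverse fg_one fg_inv fg_mul.
Proof. by move=> u; apply/val_inj/reduce_catVw/word_reduced. Qed.

Lemma fg_mulrV : right_inverse fg_one fg_inv fg_mul.
Proof.
move=> u; apply/val_inj => /=; rewrite -[X in reduce_cat X]inv_wordK.
exact/reduce_catVw/inv_word_reduced/word_reduced.
Qed.

HB.instance Definition _ := isGroup.Build (freeGroup T)
  fg_mulA fg_mul1 fg_mulr1 fg_mulV fg_mulrV.

Definition fg_gen (t : T) : freeGroup T := @FreeGroup T [:: (t, false)] isT.

Section Lift.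
Variables (G : groupType) (f : T -> G).

Definition lift_letter (a : T * bool) : G := if a.2 then (f a.1)^-1 else f a.1.

Definition lift_word (s : seq (T * bool)) : G :=
  foldr (fun a x => lift_letter a * x) 1 s.

(* The homomorphism given by the universal property of the free group. *)
Definition fg_lift (w : freeGroup T) : G := lift_word w.

Lemma lift_letterV a : lift_letter (inv_letter a) = (lift_letter a)^-1.
Proof. by case: a => t []; rewrite /lift_letter //= invgK. Qed.

Lemma lift_cons a (s : seq (T * bool)) :
  lift_word (cons_letter a s) = lift_letter a * lift_word s.
Proof.
case: s => [|b s] //=; have [->|_ //] := eqVneq b (inv_letter a).
by rewrite /= lift_letterV mulgA mulgV mul1g.
Qed.

Lemma fg_liftM : {morph fg_lift : u v / u * v}.
Proof.
move=> u v; rewrite /fg_lift /=; elim: (word u) => /= [|a s IHs].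
  by rewrite mul1g.
by rewrite lift_cons IHs mulgA.
Qed.

HB.instance Definition _ :=
  isMultiplicative.Build (freeGroup T) G fg_lift fg_liftM.

Lemma fg_lift_gen t : fg_lift (fg_gen t) = f t.
Proof. exact: mulg1. Qed.

End Lift.

Lemma morph1 (G H : groupType) (g : G -> H) :
  {morph g : x y / x * y} -> g 1 = 1.
Proof. by move=> gM; apply: (@mulgI _ (g 1)); rewrite -gM !mulg1. Qed.

Lemma morphV (G H : groupType) (g : G -> H) :
  {morph g : x y / x * y} -> {morph g : x / x^-1}.
Proof.
move=> gM x; apply: (@mulgI _ (g x)).
by rewrite -gM !mulgV; apply: morph1.
Qed.

Lemma fg_liftE (G : groupType) (g : freeGroup T -> G) :
  {morph g : u v / u * v} -> g =1 fg_lift (g \o fg_gen).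
Proof.
move=> gM [w rw]; rewrite /fg_lift /=.
elim: w rw => [|a w IHw] rw /=.
  by rewrite -(morph1 gM); congr g; apply/val_inj.
rewrite -(IHw (reduced_tail rw)).
have -> : lift_letter (g \o fg_gen) a = g (@FreeGroup T [:: a] isT).
  case: a {rw} => t [] //; rewrite /lift_letter /= -(morphV gM).
  by congr g; apply/val_inj.
by rewrite -gM; congr g; apply/val_inj => /=; rewrite cons_letter_id.
Qed.

Lemma fg_ext (G : groupType) (g h : freeGroup T -> G) :
  {morph g : u v / u * v} -> {morph h : u v / u * v} ->
  (forall t, g (fg_gen t) = h (fg_gen t)) -> g =1 h.
Proof.
move=> gM hM gh u; rewrite (fg_liftE gM) (fg_liftE hM).
by congr (fg_lift _ u); apply/funext => t; apply: gh.
Qed.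

End FreeGroup.

Record aut (G : groupType) := Aut {
  aut_fun :> G -> G;
  autM : {morph aut_fun : x y / x * y};
  aut_bij : bijective aut_fun }.

Section AutGroup.
Variable G : groupType.
Implicit Types f g h : aut G.

HB.instance Definition _ := gen_eqMixin (aut G).
HB.instance Definition _ := gen_choiceMixin (aut G).

Lemma autP f g : f =1 g -> f = g.
Proof.
case: f g => [f fM fb] [g gM gb] /= /funext fg.
move: fM fb; rewrite fg => fM fb.
by rewrite (Prop_irrelevance fM gM) (Prop_irrelevance fb gb).
Qed.

Lemma aut_surj f y : exists x, f x == y.
Proof. by have [g _ gK] := aut_bij f; exists (g y); rewrite gK. Qed.

Definition aut_inv_fun f (y : G) : G := xchoose (aut_surj f y).

Lemma aut_inv_funK f : cancel (aut_inv_fun f) f.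
Proof. by move=> y; apply/eqP/(xchooseP (aut_surj f y)). Qed.

Lemma aut_funK f : cancel f (aut_inv_fun f).
Proof. by move=> x; apply: (bij_inj (aut_bij f)); rewrite aut_inv_funK. Qed.

Lemma aut_inv_funM f : {morph aut_inv_fun f : x y / x * y}.
Proof.
move=> x y; apply: (bij_inj (aut_bij f)).
by rewrite (autM f) !aut_inv_funK.
Qed.

Definition aut_one : aut G :=
  @Aut G id (fun _ _ => erefl) (Bijective (frefl id) (frefl id)).
Definition aut_inv f : aut G :=
  Aut (@aut_inv_funM f) (Bijective (@aut_inv_funK f) (@aut_funK f)).

Lemma aut_compM f g : {morph f \o g : x y / x * y}.
Proof. by move=> x y /=; rewrite (autM g) (autM f). Qed.

(* f * g is the composite applying g first. *)
Definition aut_mul f g : aut G :=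
  Aut (@aut_compM f g) (bij_comp (aut_bij f) (aut_bij g)).

Lemma aut_mulA : associative aut_mul.
Proof. by move=> f g h; apply: autP. Qed.
Lemma aut_mul1 : left_id aut_one aut_mul.
Proof. by move=> f; apply: autP. Qed.
Lemma aut_mulr1 : right_id aut_one aut_mul.
Proof. by move=> f; apply: autP. Qed.
Lemma aut_mulV : left_inverse aut_one aut_inv aut_mul.
Proof. by move=> f; apply: autP => x /=; apply: aut_funK. Qed.
Lemma aut_mulrV : right_inverse aut_one aut_inv aut_mul.
Proof. by move=> f; apply: autP => x /=; apply: aut_inv_funK. Qed.

HB.instance Definition _ := isGroup.Build (aut G)
  aut_mulA aut_mul1 aut_mulr1 aut_mulV aut_mulrV.

End AutGroup.

Section Subgroups.
Variable G : groupType.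

Definition is_subgroup (H : set G) : Prop :=
  H 1 /\ forall x y, H x -> H y -> H (x / y).

Definition generated (S : set G) : set G := smallest is_subgroup S.

Definition derived (H : set G) : set G :=
  generated [set [~ x, y] | x in H & y in H].

Definition lcoset (x : G) (H : set G) : set G := [set x * h | h in H].

(* The abelianization G / G', as a set of cosets. *)
Definition abelianization : set (set G) :=
  [set lcoset x (derived [set: G]) | x in [set: G]].

(* f acts on G / G' by sending a coset to its image under f. *)
Definition IA : set (aut G) :=
  [set f : aut G | forall C, abelianization C -> f @` C = C].

End Subgroups.

Arguments IA G : clear implicits.

Section Palindromic.
Variable n : nat.
Local Notation F := (freeGroup 'I_n).

Definition palindrome (w : F) : Prop := rev (word w) = word w.

Definition PiA : set (aut F) :=
  [set f : aut F | forall i : 'I_n, palindrome (f (fg_gen i))].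

Section Mu.
Variables (i j : 'I_n) (ij : i != j).
Local Notation x := (@fg_gen 'I_n).

Definition mu_fun : F -> F :=
  fg_lift (fun k => if k == i then x j * x i * x j else x k).
Definition mu_inv_fun : F -> F :=
  fg_lift (fun k => if k == i then (x j)^-1 * x i * (x j)^-1 else x k).

Lemma mu_funK : cancel mu_fun mu_inv_fun.
Proof.
have ji : (j == i) = false by rewrite eq_sym (negbTE ij).
apply: (@fg_ext _ _ (mu_inv_fun \o mu_fun) id) => // [u v|k] /=.
  by rewrite /mu_inv_fun /mu_fun !fg_liftM.
rewrite /mu_fun fg_lift_gen; case: (eqVneq k i) => [->|ki].
  rewrite /mu_inv_fun !fg_liftM !fg_lift_gen eqxx ji.
  by rewrite !mulgA mulgV mul1g -mulgA mulVg mulg1.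
by rewrite /mu_inv_fun fg_lift_gen (negbTE ki).
Qed.

Lemma mu_inv_funK : cancel mu_inv_fun mu_fun.
Proof.
have ji : (j == i) = false by rewrite eq_sym (negbTE ij).
apply: (@fg_ext _ _ (mu_fun \o mu_inv_fun) id) => // [u v|k] /=.
  by rewrite /mu_inv_fun /mu_fun !fg_liftM.
rewrite /mu_inv_fun fg_lift_gen; case: (eqVneq k i) => [->|ki].
  rewrite /mu_fun !fg_liftM !(morphV (fg_liftM _)) !fg_lift_gen eqxx ji.
  by rewrite !mulgA mulVg mul1g -mulgA mulgV mulg1.
by rewrite /mu_fun fg_lift_gen (negbTE ki).
Qed.

Definition mu : aut F :=
  Aut (fg_liftM _ : {morph mu_fun : u v / u * v})
      (Bijective mu_funK mu_inv_funK).

End Mu.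

Definition EPiA : set (aut F) :=
  generated [set f : aut F | exists i j (ij : i != j), f = mu ij].

Definition PI : set (aut F) := IA F `&` PiA.

End Palindromic.

Arguments PiA n : clear implicits.
Arguments EPiA n : clear implicits.
Arguments PI n : clear implicits.

(* Main.v *)
Require Import Defs.
From mathcomp Require Import all_boot.
From mathcomp Require Import boolp classical_sets.
From mathcomp Require Import ssralg zmodp.
From mathcomp Require Import zify.

(** Why the theorem is true.

    Write E for the elementary palindromic group and E' for its derived
    subgroup.  The inclusion of the right-hand side in the left-hand side is
    formal: E' is contained in E, and E is contained in the palindromic group
    because a palindrome is exactly a word w that the letterwise inversion [bar]
    sends to w^-1, so that the palindromic automorphisms form the centraliser
    of [bar] (lemma [PiAP]).

    For the other inclusion, let f be a palindromic automorphism acting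
    trivially on the abelianization.

    Step 1: f lies in E.  This is Nielsen reduction.  The images f (x_i) are
    palindromes of odd length ([PiA_odd_size]).  If the images of two distinct
    letters share a prefix longer than half of the shorter one, then multiplying
    the longer one on both sides by the inverse of the shorter one shortens it
    ([shared_half_shortens]); this replaces f by f * mu_ij^{+-1}.  If there is
    no such pair, the central letter of each image survives in every reduced
    product ([leading_half_survives]), which forces each generator to be the
    image of a letter ([no_overlap_permutes]).  Hence f * e permutes the
    letters for some e in E ([PiA_reduction]).  Modulo 4, the exponent of x_j
    in e (x_i) is delta_ij + 2 c_ij, where c_ij counts the factors
    mu_ij^{+-1} of e ([exponent4_mu_word]).  As f preserves exponent sums,
    f * e has to fix each generator, and f = e^-1 ([PI_sub_EPiA]).

    Step 2: f lies in E'.  As n >= 3, each mu_ik^2 lies in E': conjugating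
    mu_ij by mu_jk gives mu_ik mu_ij mu_ik ([mu_conj]).  So a product of
    elementary automorphisms depends, modulo E', only on the parities of the
    counts c_ij.  These parities are read off from the action on exponent sums
    modulo 4, and for f they are all even ([IA_EPiA_derived]). *)

Set Implicit Arguments.
Unset Strict Implicit.
Unset Printing Implicit Defensive.

Local Open Scope classical_set_scope.
Local Open Scope group_scope.

(** * Computing modulo the derived subgroup *)
Section Subgroups.
Variable G : groupType.
Implicit Types (H S : set G) (x y : G).

Lemma is_subgroup1 H : is_subgroup H -> H 1.
Proof. by case. Qed.

Lemma is_subgroupV H x : is_subgroup H -> H x -> H x^-1.
Proof. by case=> H1 HF /(HF _ _ H1); rewrite mul1g. Qed.

Lemma is_subgroupM H x y : is_subgroup H -> H x -> H y -> H (x * y).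
Proof.
by move=> sH Hx /(is_subgroupV sH) /(sH.2 _ _ Hx); rewrite invgK.
Qed.

Lemma generated_subgroup S : is_subgroup (generated S).
Proof.
split=> [A [[]] //|x y Sx Sy A AS]; have [sA _] := AS.
by apply: sA.2; [apply: Sx|apply: Sy].
Qed.

Lemma generated_sub S H : is_subgroup H -> S `<=` H -> generated S `<=` H.
Proof. exact: smallest_sub. Qed.

Lemma mem_generated S : S `<=` generated S.
Proof. exact: sub_gen_smallest. Qed.

Lemma derived_subgroup H : is_subgroup (derived H).
Proof. exact: generated_subgroup. Qed.

Lemma derivedR H x y : H x -> H y -> derived H [~ x, y].
Proof. by move=> Hx Hy; apply: mem_generated; exists x => //; exists y. Qed.

Lemma derived_sub H : is_subgroup H -> derived H `<=` H.
Proof.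
move=> sH; apply: generated_sub => // _ [x Hx [y Hy <-]].
rewrite /commg /conjg; have [Vx Vy] := (is_subgroupV sH Hx, is_subgroupV sH Hy).
by do !apply: (is_subgroupM sH).
Qed.

(** The quotient by the derived subgroup is used only through membership: this
    lemma and the next one say that factors of a product may be permuted. *)
Lemma derived_cyclic H x y : is_subgroup H -> H x -> H y ->
  derived H (x * y) -> derived H (y * x).
Proof.
move=> sH Hx Hy Dxy; have -> : y * x = x * y * [~ x * y, x].
  by rewrite /commg mulVKg /conjg !mulgA mulVg mul1g.
apply: (is_subgroupM (derived_subgroup H)) => //; apply: derivedR => //.
exact: is_subgroupM.
Qed.

Lemma derived_swap H a u v b : is_subgroup H -> H a -> H u -> H v -> H b ->
  derived H (a * u * v * b) -> derived H (a * v * u * b).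
Proof.
move=> sH Ha Hu Hv Hb D.
have {}D : derived H (b * a * u * v).
  have -> : b * a * u * v = b * (a * u * v) by rewrite !mulgA.
  by apply: derived_cyclic => //; do !apply: (is_subgroupM sH).
suff: derived H (b * (a * v * u)).
  by apply: derived_cyclic => //; do 2?[apply: (is_subgroupM sH) => //].
have -> : b * (a * v * u) = b * a * u * v * [~ v, u].
  by rewrite -!mulgA (commgC v u) !mulgA.
by apply: (is_subgroupM (derived_subgroup H)) => //; apply: derivedR.
Qed.
End Subgroups.

(** * Words in the elementary palindromic automorphisms *)
Section ElementaryWords.
Variable n : nat.
Local Notation F := (freeGroup 'I_n).
Local Notation x := (@fg_gen 'I_n).

Lemma aut_mulE (f g : aut F) w : (f * g) w = f (g w).
Proof. by []. Qed.

Lemma autV (f : aut F) w : f w^-1 = (f w)^-1.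
Proof. exact: (morphV (autM f)). Qed.

Lemma autKV (f : aut F) : cancel f^-1 f.
Proof. by move=> w; rewrite -aut_mulE mulgV. Qed.

Lemma aut_ext (f g : aut F) : (forall i, f (x i) = g (x i)) -> f = g.
Proof. by move=> fg; apply/autP/fg_ext => //; apply: autM. Qed.

Definition mu_index := {p : 'I_n * 'I_n | p.1 != p.2}.

Definition signed_mu (q : mu_index * bool) : aut F :=
  if q.2 then (mu (valP q.1))^-1 else mu (valP q.1).

Definition mu_word (l : seq (mu_index * bool)) : aut F :=
  \prod_(q <- l) signed_mu q.

Lemma mu_gen i j (ij : i != j) k :
  mu ij (x k) = if k == i then x j * x i * x j else x k.
Proof. exact: fg_lift_gen. Qed.

Lemma muV_gen i j (ij : i != j) k :
  (mu ij)^-1 (x k) = if k == i then (x j)^-1 * x i * (x j)^-1 else x k.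
Proof.
have -> : (mu ij)^-1 (x k) = mu_inv_fun i j (x k).
  by rewrite -[in RHS](autKV (mu ij) (x k)); apply/esym/mu_funK.
exact: fg_lift_gen.
Qed.

Lemma signed_mu_gen q k : signed_mu q (x k) =
  if k == (val q.1).1 then
    lift_letter x ((val q.1).2, q.2) * x k * lift_letter x ((val q.1).2, q.2)
  else x k.
Proof.
rewrite /signed_mu /lift_letter /=; case: q.2; rewrite ?mu_gen ?muV_gen;
by case: eqP => [->|].
Qed.

Lemma signed_mu_inv q : (signed_mu q)^-1 = signed_mu (q.1, ~~ q.2).
Proof. by rewrite /signed_mu /=; case: q.2; rewrite ?invgK. Qed.

Lemma mu_word_cat l1 l2 : mu_word (l1 ++ l2) = mu_word l1 * mu_word l2.
Proof. exact: big_cat. Qed.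

Lemma mu_word_cons q l : mu_word (q :: l) = signed_mu q * mu_word l.
Proof. exact: big_cons. Qed.

Lemma mu_word_rcons q l : mu_word (rcons l q) = mu_word l * signed_mu q.
Proof. by rewrite -cats1 mu_word_cat /mu_word big_seq1. Qed.

Lemma mu_wordV l : exists l', (mu_word l)^-1 = mu_word l'.
Proof.
elim: l => [|q l [l' IH]].
  by exists [::]; rewrite /mu_word big_nil invg1.
exists (rcons l' (q.1, ~~ q.2)).
by rewrite mu_word_cons mu_word_rcons invgM IH signed_mu_inv.
Qed.

Lemma EPiA_subgroup : is_subgroup (EPiA n).
Proof. exact: generated_subgroup. Qed.

Lemma EPiA_mu i j (ij : i != j) : EPiA n (mu ij).
Proof. by apply: mem_generated; exists i, j, ij. Qed.

Lemma EPiA_signed_mu q : EPiA n (signed_mu q).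
Proof.
rewrite /signed_mu; case: q.2; last exact: EPiA_mu.
by apply: (is_subgroupV EPiA_subgroup); apply: EPiA_mu.
Qed.

Lemma EPiA_mu_word l : EPiA n (mu_word l).
Proof.
elim: l => [|q l IH]; first by rewrite /mu_word big_nil; case: EPiA_subgroup.
rewrite mu_word_cons; apply: (is_subgroupM EPiA_subgroup) => //.
exact: EPiA_signed_mu.
Qed.

Lemma EPiA_word f : EPiA n f -> exists l, f = mu_word l.
Proof.
move: f; apply: (@generated_sub _ _ [set f | exists l, f = mu_word l]).
  split=> [|_ _ [l1 ->] [l2 ->]];
    first by exists [::]; rewrite /mu_word big_nil.
  by have [l ->] := mu_wordV l2; exists (l1 ++ l); rewrite mu_word_cat.
move=> _ [i [j [ij ->]]]; exists [:: (exist _ (i, j) ij, false)].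
rewrite /mu_word big_seq1 /signed_mu /=; congr mu.
exact: bool_irrelevance.
Qed.

(** Modulo commutators this relation reads mu_ik^2 = 1: after cancelling
    mu_ij and mu_jk on both sides, two factors mu_ik remain.  This is
    what a third index is for. *)
Lemma mu_conj (i j k : 'I_n) (ij : i != j) (jk : j != k) (ik : i != k) :
  mu jk * mu ij = mu ik * mu ij * mu ik * mu jk :> aut F.
Proof.
have [ji kj ki] : [/\ j == i = false, k == j = false & k == i = false].
  by split; apply: negbTE; rewrite eq_sym.
move: (mu ij) (mu jk) (mu ik) (mu_gen ij) (mu_gen jk) (mu_gen ik).
move=> f g h fE gE hE; apply: aut_ext => m; rewrite !aut_mulE.
have fj : f (x j) = x j by rewrite fE ji.
have hj : h (x j) = x j by rewrite hE ji.
have hk : h (x k) = x k by rewrite hE ki.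
have fk : f (x k) = x k by rewrite fE ki.
have gi : g (x i) = x i by rewrite gE (negbTE ij).
have gj : g (x j) = x k * x j * x k by rewrite gE eqxx.
have fi : f (x i) = x j * x i * x j by rewrite fE eqxx.
have hi : h (x i) = x k * x i * x k by rewrite hE eqxx.
have [->|mi] := eqVneq m i.
  rewrite gi fi hi.
  rewrite !(autM g) gi gj !(autM f) fk fi !(autM h) hk hj hi.
  by rewrite !mulgA.
have [->|mj] := eqVneq m j.
  by rewrite fj gj !(autM h) hk hj !(autM f) fk fj !(autM h) hk hj.
rewrite !gE (negbTE mj) hE (negbTE mi) fE (negbTE mi) hE (negbTE mi).
by rewrite gE (negbTE mj).
Qed.

Lemma third_index (i k : 'I_n) : 3 <= n -> exists2 j, i != j & j != k.
Proof.
move=> n3; have lt_n : #|[set i; k]%SET| < #|'I_n|.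
  by rewrite cards2 card_ord; apply: leq_trans n3; case: (_ != _).
have /card_gt0P[j] : 0 < #|~: [set i; k]%SET|.
  by rewrite -(ltn_add2l #|[set i; k]%SET|) addn0 cardsC.
by rewrite !inE negb_or => /andP[ji jk]; exists j; rewrite 1?eq_sym // eq_sym.
Qed.

Lemma derived_mu2 i k (ik : i != k) : 3 <= n ->
  derived (EPiA n) (mu ik * mu ik).
Proof.
move=> /(third_index i k)[j ij jk].
have sE := EPiA_subgroup.
have EV a b (ab : a != b) : EPiA n (mu ab)^-1.
  by apply: (is_subgroupV sE); apply: EPiA_mu.
have : derived (EPiA n) [~ (mu jk)^-1, (mu ij)^-1].
  by apply: derivedR; apply: EV.
rewrite /commg /conjg !invgK !mulgA (mu_conj ij jk ik) mulgK.
move=> D; rewrite -[_ * _](mulgK (mu ij)).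
by apply: derived_swap; rewrite ?mulgA //; try exact: EPiA_mu; apply: EV.
Qed.

(** Equal or mutually inverse factors cancel in pairs, since mu and its inverse
    agree modulo the derived subgroup, in which mu^2 lies. *)
Lemma derived_mu_word l : 3 <= n ->
  (forall p, ~~ odd (count (fun q : mu_index * bool => q.1 == p) l)) ->
  derived (EPiA n) (mu_word l).
Proof.
move=> n3; have sE := EPiA_subgroup; have sD := derived_subgroup (EPiA n).
have pairD q r : q.1 = r.1 -> derived (EPiA n) (signed_mu q * signed_mu r).
  case: q r => [p b] [_ c] /= <-; rewrite /signed_mu /=.
  have D2 := derived_mu2 (valP p) n3.
  case: b; case: c; rewrite ?mulVg ?mulgV //; try exact: is_subgroup1.
  by rewrite -invgM; apply: (is_subgroupV sD).
have [m] := ubnP (size l); elim: m l => // m IH [|q l] /=.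
  by move=> _ _; rewrite /mu_word big_nil; apply: is_subgroup1.
rewrite ltnS => lt_l even_l.
have : has (fun r => r.1 == q.1) l.
  rewrite has_count lt0n; apply: contraTneq (even_l q.1) => ->.
  by rewrite eqxx.
case/hasP => r /splitPr l_r /eqP rq.
case: l_r lt_l even_l => l1 l2 lt_l even_l.
have D12 : derived (EPiA n) (mu_word (l1 ++ l2)).
  apply: IH => [|p];
    first by move: lt_l; rewrite !size_cat /= addnS; apply: leq_trans.
  have := even_l p; rewrite !count_cat /= rq; case: (q.1 == p) => //.
  by rewrite !oddD; do 2!case: (odd (count _ _)).
have -> : mu_word (q :: l1 ++ r :: l2) =
    signed_mu q * mu_word l1 * signed_mu r * mu_word l2.
  by rewrite mu_word_cons mu_word_cat mu_word_cons !mulgA.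
apply: derived_swap => //; try exact: EPiA_signed_mu; try exact: EPiA_mu_word.
rewrite -mulgA -mu_word_cat.
by apply: (is_subgroupM sD) => //; apply: pairD.
Qed.

End ElementaryWords.

(** * Exponent sums modulo 4 *)
Section ExponentSums.
Variable n : nat.
Local Notation F := (freeGroup 'I_n).
Local Notation x := (@fg_gen 'I_n).
Import GRing.Theory.

Definition exponent4 (k : 'I_n) : F -> 'Z_4 :=
  fg_lift (fun i => (i == k)%:R%R : 'Z_4).

Lemma exponent4M k u v :
  exponent4 k (u * v) = (exponent4 k u + exponent4 k v)%R.
Proof. exact: fg_liftM. Qed.

Lemma exponent4V k u : exponent4 k u^-1 = (- exponent4 k u)%R.
Proof. exact: (morphV (fg_liftM _)). Qed.

Lemma exponent4_gen k i : exponent4 k (x i) = (i == k)%:R%R.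
Proof. exact: fg_lift_gen. Qed.

Lemma Z4_natP a b : (a%:R = b%:R :> 'Z_4)%R <-> a = b %[mod 4].
Proof.
split=> [/(congr1 val)|ab]; first by rewrite /= !val_Zp_nat.
by apply/val_inj; rewrite /= !val_Zp_nat.
Qed.

(** Modulo 4 the matrices 1 + 2 A multiply by adding the A modulo 2, and signs
    are lost because 2 = -2; so only the number of factors with a given pair of
    indices is visible. *)
Lemma exponent4_mu_word l k m : exponent4 k (mu_word l (x m)) =
  ((m == k) + 2 * count (fun q => val q.1 == (m, k)) l)%:R%R.
Proof.
elim/last_ind: l m => [|l q IH] m.
  by rewrite /mu_word big_nil exponent4_gen /= muln0 addn0.
rewrite mu_word_rcons aut_mulE signed_mu_gen -cats1 count_cat /= addn0.
case: q => [[[i j] /= ij] b] /=; rewrite xpair_eqE /=.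
have [->|mi] := eqVneq m i; last first.
  by rewrite IH addn0.
rewrite /= !autM !exponent4M IH /lift_letter /=.
(* The exponent is delta_jk modulo 2, so its double is known modulo 4. *)
have two : (exponent4 k (mu_word l (x j)) *+ 2 = (2 * (j == k))%:R)%R.
  rewrite IH -mulrnA; apply/Z4_natP; move: (count _ l) => c.
  by move: (nat_of_bool _) => d; lia.
case: b; rewrite ?autV ?exponent4V addrAC -mulr2n ?mulNrn two.
  by apply: (canLR (addKr _)); rewrite -natrD; apply/Z4_natP; lia.
by rewrite -natrD; apply/Z4_natP; lia.
Qed.

Lemma exponent4_derived k : derived [set: F] `<=` [set u | exponent4 k u = 0%R].
Proof.
apply: generated_sub.
  split=> [|u v]; first exact: (morph1 (fg_liftM _)).
  by rewrite /= exponent4M exponent4V => -> ->; rewrite subr0.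
move=> _ [u _ [v _ <-]] /=; rewrite /commg /conjg !exponent4M !exponent4V.
by rewrite addrA -opprD addNr.
Qed.

Lemma IA_exponent4 f k u : IA F f -> exponent4 k (f u) = exponent4 k u.
Proof.
move=> fIA; pose C := lcoset u (derived [set: F]).
have fC : f @` C = C by apply: fIA; exists u.
have : (f @` C) (f u).
  exists u => //; exists 1; last exact: mulg1.
  exact: is_subgroup1 (derived_subgroup _).
rewrite fC => -[d /(@exponent4_derived k) d0 <-].
by rewrite exponent4M d0 addr0.
Qed.

Lemma IA_EPiA_derived f : 3 <= n -> IA F f -> EPiA n f -> derived (EPiA n) f.
Proof.
move=> n3 fIA /EPiA_word[l fl]; rewrite fl; apply: derived_mu_word => //.
move=> -[[m k] mk].
have := IA_exponent4 k (x m) fIA; rewrite fl exponent4_mu_word exponent4_gen.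
move/Z4_natP.
have -> : count (fun q => q.1 == exist _ (m, k) mk) l =
    count (fun q => val q.1 == (m, k)) l by apply: eq_count.
by move: (count _ l) (nat_of_bool _) => c d; lia.
Qed.

End ExponentSums.

(** * Palindromic automorphisms as a centraliser *)
Section Bar.
Variable n : nat.
Local Notation F := (freeGroup 'I_n).
Local Notation x := (@fg_gen 'I_n).
Implicit Types (u v w : F) (f : aut F).

(** Reversal of words is an anti-automorphism.  Composing it with inversion
    gives this automorphism, which inverts every letter in place; it stands for
    reversal below because it is a homomorphism. *)
Definition bar : F -> F := fg_lift (fun i => (x i)^-1).

Lemma barM : {morph bar : u v / u * v}.
Proof. exact: fg_liftM. Qed.

Lemma barV w : bar w^-1 = (bar w)^-1.
Proof. exact: (morphV barM). Qed.

Lemma bar_gen i : bar (x i) = (x i)^-1.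
Proof. exact: fg_lift_gen. Qed.

Lemma word_lift_gen (s : seq ('I_n * bool)) :
  reduced s -> word (lift_word x s) = s.
Proof.
elim: s => //= a s IH ras; rewrite (IH (reduced_tail ras)).
have -> : word (lift_letter x a) = [:: a] by case: a {ras} => i [].
exact: cons_letter_id.
Qed.

Lemma lift_gen w : lift_word x (word w) = w.
Proof. by apply/val_inj/word_lift_gen/word_reduced. Qed.

Lemma map_inv_reduced (s : seq ('I_n * bool)) :
  reduced s -> reduced (map (@inv_letter _) s).
Proof.
rewrite /reduced sorted_map; apply: sub_sorted => a b /=.
by apply: contra => /eqP /(can_inj (@inv_letterK _)) ->.
Qed.

Lemma word_bar w : word (bar w) = map (@inv_letter _) (word w).
Proof.
rewrite -[LHS](word_lift_gen (word_reduced _)) lift_gen -{2}(lift_gen w).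
rewrite /bar /fg_lift; elim: (word w) (word_reduced w) => //= a s IH ras.
have rs := reduced_tail ras; rewrite (IH rs) word_lift_gen //.
have -> : word (lift_letter (fun i => (x i)^-1) a) = [:: inv_letter a].
  by case: a {ras} => i [].
have -> : word (lift_letter x a) = [:: a] by case: a {ras} => i [].
by rewrite /= !cons_letter_id // (@map_inv_reduced (a :: s)).
Qed.

Lemma palindromeP w : palindrome w <-> bar w = w^-1.
Proof.
rewrite /palindrome; split=> [pw|/(congr1 (@word _))].
  by apply/val_inj; rewrite /= word_bar /inv_word -map_rev pw.
rewrite word_bar /= /inv_word -map_rev => /esym.
exact: (inj_map (can_inj (@inv_letterK _))).
Qed.

Lemma PiAP f : PiA n f <-> (forall w, f (bar w) = bar (f w)).
Proof.
split=> [fP w|fB i].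
  apply: (@fg_ext _ _ (f \o bar) (bar \o f)) => [u v|u v|i] /=.
  - by rewrite barM autM.
  - by rewrite autM barM.
  - by rewrite bar_gen autV (palindromeP _).1.
by apply/palindromeP; rewrite -fB bar_gen autV.
Qed.

(** Closure under inverses is not visible on the generators; it comes from the
    description as a centraliser. *)
Lemma PiA_subgroup : is_subgroup (PiA n).
Proof.
split=> [|f g /PiAP fB /PiAP gB]; apply/PiAP => // w.
rewrite !aut_mulE -fB; congr (aut_fun f _).
by apply: (bij_inj (aut_bij g)); rewrite gB !autKV.
Qed.

Lemma EPiA_sub_PiA : EPiA n `<=` PiA n.
Proof.
apply: generated_sub; first exact: PiA_subgroup.
move=> _ [i [j [ij ->]]] k; apply/palindromeP; rewrite mu_gen.
by case: eqP => _; rewrite ?barM !bar_gen ?invgM ?mulgA.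
Qed.

End Bar.

(** * Lengths and cancellation *)
Section Lengths.
Variable n : nat.
Local Notation F := (freeGroup 'I_n).
Local Notation x := (@fg_gen 'I_n).
Implicit Types (u v w P Q : F) (f : aut F).
Implicit Types (a b : 'I_n * bool) (s : seq ('I_n * bool)).

Lemma lift_word_cat (G : groupType) (g : 'I_n -> G) s1 s2 :
  lift_word g (s1 ++ s2) = lift_word g s1 * lift_word g s2.
Proof. by elim: s1 => [|a s IH] /=; rewrite ?mul1g // IH mulgA. Qed.

Lemma lift_word_rev s : lift_word x (rev s) = (bar (lift_word x s))^-1.
Proof.
elim: s => [|a s IH]; first by rewrite /= (morph1 (@barM n)) invg1.
rewrite rev_cons -cats1 lift_word_cat IH /= barM invgM mulg1.
by congr (_ * _); case: a => i []; rewrite /lift_letter /= ?barV bar_gen !invgK.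
Qed.

Lemma size_cons_letter a s : size (cons_letter a s) <= (size s).+1.
Proof. by case: s => //= b s; case: ifP => //= _; rewrite ltnW. Qed.

Lemma size_lift_word s : size (word (lift_word x s)) <= size s.
Proof.
elim: s => //= a s IH.
have -> : word (lift_letter x a) = [:: a] by case: a => i [].
by rewrite /= (leq_trans (size_cons_letter _ _)).
Qed.

Lemma size_mul u v : size (word (u * v)) <= size (word u) + size (word v).
Proof.
rewrite -{1}(lift_gen u) -{1}(lift_gen v) -lift_word_cat -size_cat.
exact: size_lift_word.
Qed.

Lemma size_inv u : size (word u^-1) = size (word u).
Proof. by rewrite /= /inv_word size_rev size_map. Qed.

(** Here c is what cancels: u ends with the inverse of c and v begins with c. *)
Lemma reduce_catP (u v : seq ('I_n * bool)) : reduced u -> reduced v ->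
  exists u' c v' : seq ('I_n * bool),
    [/\ u = u' ++ inv_word c, v = c ++ v' & reduce_cat u v = u' ++ v'].
Proof.
move=> + rv; elim: u => [|a u IH] rau; first by exists [::], [::], v.
have [u' [c [v' [uE vE uvE]]]] := IH (reduced_tail rau).
rewrite /= uvE; case: u' => [|b u'] in uE uvE *; last first.
  exists (a :: b :: u'), c, v'; split=> //; first by rewrite uE.
  by move: rau; rewrite uE /= => /andP[/negbTE ->].
case: v' => [|b v'] /= in vE uvE *.
  by exists [:: a], c, [::]; split=> //; rewrite uE.
case: eqP => [ba|_];
  last by exists [:: a], c, (b :: v'); split=> //; rewrite uE.
exists [::], (rcons c b), v'; split=> //; last by rewrite cat_rcons.
by rewrite uE /inv_word map_rcons rev_rcons ba inv_letterK.
Qed.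

Lemma exponent4_bar k w : exponent4 k (bar w) = (- exponent4 k w)%R.
Proof.
rewrite -exponent4V; move: w.
refine (fg_ext (g := exponent4 k \o @bar n)
  (h := fun w => exponent4 k w^-1) _ _ _).
- by move=> u v; rewrite [LHS](congr1 (exponent4 k) (barM u v)) exponent4M.
- by move=> u v; rewrite invgM exponent4M GRing.addrC.
- by move=> i; rewrite -bar_gen.
Qed.

Lemma palindrome_drop s m : rev s = s -> drop m s = rev (take (size s - m) s).
Proof. by move=> ps; rewrite -{1}ps drop_rev. Qed.

(** A palindrome of even length is u * (bar u)^-1.  If f (x i) were of this
    form, so would be x i, since f^-1 commutes with [bar]; but every exponent
    sum of v * (bar v)^-1 is even. *)
Lemma PiA_odd_size f i : PiA n f -> odd (size (word (f (x i)))).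
Proof.
move=> fP; have := fP i; rewrite /palindrome.
move E : (word (f (x i))) => s ps; apply/negPn/negP => even_s.
have [h hE] : exists h, size s = h + h.
  by exists (size s)./2; rewrite addnn even_halfK // negbTE.
pose v := f^-1 (lift_word x (take h s)).
have xE : x i = v * (bar v)^-1.
  apply: (bij_inj (aut_bij f)); rewrite autM autV (PiAP f).1 // !autKV.
  have ds : drop h s = rev (take h s) by rewrite palindrome_drop // hE addnK.
  rewrite -lift_word_rev -(lift_gen (f (x i))) E -lift_word_cat -ds.
  by rewrite cat_take_drop.
have := congr1 (exponent4 i) xE.
rewrite exponent4_gen eqxx exponent4M exponent4V exponent4_bar GRing.opprK.
by case: (exponent4 i v) => [[|[|[|[|]]]]] // ? /(congr1 val).
Qed.

End Lengths.

(** * Nielsen reduction for palindromic bases *)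
Section NielsenReduction.
Variable n : nat.
Local Notation F := (freeGroup 'I_n).
Local Notation x := (@fg_gen 'I_n).
Implicit Types (u v w P Q : F) (f : aut F).
Implicit Types (a b : 'I_n * bool) (s : seq ('I_n * bool)).

(** Let P have length 2 h + 1 and share with Q the prefix p of length h + 1.
    Reading the palindromes from both ends, P = p t' = t p' and Q = p m p',
    where ' is reversal, so that P^-1 Q P^-1 = t'^-1 m t^-1 has lost two copies
    of p and gained two words of length h.  The two ends of Q do not meet
    because Q, having odd length too, is at least two letters longer than P; when
    the lengths agree, the shared half determines the whole palindrome. *)
Lemma shared_half_shortens P Q h :
  palindrome P -> palindrome Q ->
  size (word P) = h + h.+1 -> odd (size (word Q)) ->
  size (word P) <= size (word Q) ->
  take h.+1 (word P) = take h.+1 (word Q) ->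
  P = Q \/ size (word (P^-1 * Q * P^-1)) < size (word Q).
Proof.
rewrite /palindrome => pP pQ sP oQ; rewrite leq_eqVlt.
have dP : drop h.+1 (word P) = rev (take h (word P)).
  by rewrite palindrome_drop // sP addnK.
case/orP=> [/eqP PQ|ltPQ] takePQ; [left|right].
  have dQ : drop h.+1 (word Q) = rev (take h (word Q)).
    by rewrite palindrome_drop // -PQ sP addnK.
  apply/val_inj; rewrite /= -(cat_take_drop h.+1 (word P)).
  rewrite -(cat_take_drop h.+1 (word Q)).
  by rewrite dP dQ takePQ -(take_takel (word P) (leqnSn h)) takePQ take_takel.
have {}ltPQ : h.+1 + h.+1 < size (word Q) by lia.
set p := take h.+1 (word Q) in takePQ.
set t := take h (word P) in dP.
pose m := take (size (word Q) - h.+1 - h.+1) (drop h.+1 (word Q)).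
have QE : word Q = p ++ m ++ rev p.
  rewrite -{1}(cat_take_drop h.+1 (word Q)) -/p; congr (_ ++ _).
  rewrite -{1}(cat_take_drop (size (word Q) - h.+1 - h.+1) (drop _ _)) -/m.
  congr (_ ++ _); rewrite drop_drop subnK; last by lia.
  have lehQ : h < size (word Q) by lia.
  by rewrite (palindrome_drop _ pQ) subKn.
have PE : word P = p ++ rev t by rewrite -takePQ -dP cat_take_drop.
have PE' : word P = t ++ rev p by rewrite -pP PE rev_cat revK.
have -> : P^-1 * Q * P^-1 =
    (lift_word x (rev t))^-1 * lift_word x m * (lift_word x t)^-1.
  rewrite -{1}(lift_gen P) PE -(lift_gen Q) QE -(lift_gen P) PE' !lift_word_cat.
  rewrite !invgM !mulgA mulgVK.
  by rewrite -[_ * lift_word x (rev p) / _]mulgA mulgV mulg1.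
apply: leq_ltn_trans (size_mul _ _) _.
rewrite size_inv; apply: leq_ltn_trans
  (leq_add (size_mul _ _) (size_lift_word _)) _.
rewrite size_inv; apply: leq_ltn_trans
  (leq_add (leq_add (size_lift_word _) (size_lift_word _)) (leqnn _)) _.
rewrite size_rev; have := congr1 size QE; rewrite !size_cat size_rev => ->.
have -> : size t = h by rewrite size_take sP; case: ifP => //; lia.
have -> : size p = h.+1 by rewrite size_take; case: ifP => //; lia.
by rewrite !addSn !addnS addnA.
Qed.

Section Basis.
Variables (f : aut F) (fP : PiA n f).
Local Notation y a := (f (lift_letter x a)).
Local Notation half a := (size (word (y a)))./2.

Lemma letter_inv a : y (inv_letter a) = (y a)^-1.
Proof. by rewrite lift_letterV autV. Qed.

Lemma letter_palindrome a : palindrome (y a).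
Proof.
apply/palindromeP; rewrite -(PiAP f).1 // -autV; congr (aut_fun f _).
by case: a => i []; rewrite /lift_letter /= ?barV bar_gen.
Qed.

Lemma letter_odd a : odd (size (word (y a))).
Proof.
by case: a => i []; rewrite /lift_letter /= ?autV ?size_inv PiA_odd_size.
Qed.

Lemma letter_inj a b : y a = y b -> a = b.
Proof.
move/(bij_inj (aut_bij f)) => /(congr1 (@word _)).
by case: a b => i [] [j []] //= [->].
Qed.

(** The bound is the smaller half-length plus one, so that the shared prefix
    contains the central letter of the shorter word. *)
Definition overlap a b :=
  let m := (minn (half a) (half b)).+1 in
  take m (word (y a)) == take m (word (y b)).

Lemma overlapC a b : overlap a b = overlap b a.
Proof. by rewrite /overlap /= minnC eq_sym. Qed.

(** The images of a letter and of its inverse differ in their first letters: a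
    palindrome is inverted by inverting its letters in place. *)
Lemma overlap_inv a : ~~ overlap a (inv_letter a).
Proof.
rewrite /overlap /=; apply/negP; rewrite letter_inv.
have /palindromeP <- := letter_palindrome a; rewrite word_bar.
have := letter_odd a; case: (word (y a)) => //= c s _.
by rewrite eqseq_cons inv_letter_neq.
Qed.

(** The sign of the elementary automorphism is the one that puts the inverse of
    the shorter image on both sides of the longer one; if the longer image is
    that of an inverse letter, everything is inverted. *)
Lemma overlap_shortens a b : a != b -> overlap a b ->
  exists q, size (word (f (signed_mu q (x (val q.1).1)))) <
            size (word (f (x (val q.1).1))).
Proof.
wlog le_ba : a b / size (word (y b)) <= size (word (y a)).
  move=> W ab oab; case: (leqP (size (word (y b))) (size (word (y a)))).
    by move=> /W; apply.
  by move=> /ltnW /W; apply; rewrite 1?eq_sym // overlapC.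
move=> ab oab; have [eqi|ij] := eqVneq a.1 b.1.
  have ba : b = inv_letter a.
    case: a b eqi ab {le_ba oab} => i c [j d] /= <-; rewrite xpair_eqE eqxx /=.
    by case: c; case: d.
  by rewrite ba (negbTE (overlap_inv a)) in oab.
move: oab; rewrite /overlap /= (minn_idPr _); last exact: half_leq.
move=> /eqP /esym oab.
have sb : size (word (y b)) = half b + (half b).+1.
  by rewrite -[LHS]odd_double_half letter_odd -addnn add1n addnS.
have [|lt_ba] := shared_half_shortens (letter_palindrome b)
  (letter_palindrome a) sb (letter_odd a) le_ba oab.
  by move=> /letter_inj ba; rewrite ba eqxx in ab.
exists (exist _ (a.1, b.1) ij, a.2 == b.2); rewrite signed_mu_gen /= eqxx.
move: lt_ba; rewrite -!autV -!autM.
case: a b {le_ba ab oab ij sb} => i [] [j []];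
  rewrite /lift_letter /= ?invgK //;
  by rewrite -[X in X < _]size_inv -[X in _ < X]size_inv
    -!autV !invgM !invgK mulgA.
Qed.

Hypothesis no_overlap : forall a b, a != b -> ~~ overlap a b.

(** In a product y a * R, where R starts with the first half and the centre of
    y b, cancelling the centre of y a would make the images of a^-1 and b
    share a prefix that reaches the centre of the shorter one. *)
Lemma leading_half_survives a s : reduced (a :: s) ->
  take (half a).+1 (word (f (lift_word x (a :: s)))) =
  take (half a).+1 (word (y a)).
Proof.
elim: s a => [|b s IH] a ras; first by rewrite /= mulg1.
have {ras} [ba rbs] := andP ras.
have := IH b rbs; set R := f (lift_word x (b :: s)) => {}IH.
have -> : f (lift_word x [:: a, b & s]) = y a * R by rewrite -autM.
have [u [c [v [aE RE aRE]]]] :=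
  reduce_catP (word_reduced (y a)) (word_reduced R).
rewrite (aRE : word (y a * R) = _).
have [lt_u|le_u] := ltnP (half a) (size u).
  by rewrite takel_cat //; set k := (half a).+1; rewrite aE takel_cat.
set m := (minn (half (inv_letter a)) (half b)).+1.
have le_m : m <= size c.
  have := letter_odd a; have := congr1 size aE.
  rewrite /m letter_inv size_inv size_cat size_rev size_map.
  by move: le_u; move: (size _) (size u) (size c) (half b) => A B C D; lia.
have : ~~ overlap (inv_letter a) b by apply: no_overlap; rewrite eq_sym.
case/eqP; rewrite -/m letter_inv /= aE /inv_word map_cat rev_cat.
rewrite -/(inv_word (inv_word c)) inv_wordK takel_cat //.
have le_mb : m <= (half b).+1 by rewrite ltnS geq_minr.
by rewrite -(take_takel (word (y b)) le_mb) -IH take_takel // RE takel_cat.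
Qed.

(** Write x k as the image of a reduced word a :: s.  The first half and the
    centre of y a already occupy the only letter of x k, so y a has
    length 1 and equals x k. *)
Lemma no_overlap_permutes k : exists a, y a = x k.
Proof.
set w := f^-1 (x k); have fw : f (lift_word x (word w)) = x k.
  by rewrite lift_gen autKV.
case E : (word w) (word_reduced w) fw => [|a s] ras fw.
  by have := congr1 (@word _) fw; rewrite /= (morph1 (autM f)).
exists a; apply/val_inj => /=.
have := leading_half_survives ras; rewrite fw.
by have := letter_odd a; case: (word (y a)) => [|c [|d t]] //=.
Qed.

End Basis.
End NielsenReduction.

(** * Generation by the elementary automorphisms *)
Section Generation.
Variable n : nat.
Local Notation F := (freeGroup 'I_n).
Local Notation x := (@fg_gen 'I_n).

Lemma PiA_mu_word f l : PiA n f -> PiA n (f * mu_word l).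
Proof.
move=> fP; apply: (is_subgroupM (@PiA_subgroup n)) => //.
by apply: EPiA_sub_PiA; apply: EPiA_mu_word.
Qed.

Lemma PiA_reduction f : PiA n f ->
  exists l, forall k, exists a, (f * mu_word l) (lift_letter x a) = x k.
Proof.
have [m] := ubnP (\sum_i size (word (f (x i)))).
elim: m f => // m IH f; rewrite ltnS => lt_f fP.
have [no|] := pselect (forall a b, a != b -> ~~ overlap f a b).
  exists [::] => k; have [a fa] := no_overlap_permutes fP no k.
  by exists a; rewrite /mu_word big_nil mulg1.
move=> /existsNP[a /existsNP[b /not_implyP[ab /negP/negPn oab]]].
have [q lt_q] := overlap_shortens fP ab oab.
have [||l fl] := IH (f * signed_mu q).
- apply: leq_trans lt_f; set i := (val q.1).1 in lt_q.
  rewrite (bigD1 i) //= [X in _ < X](bigD1 i) //=.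
  rewrite -addSn leq_add // leq_sum // => j ji.
  by rewrite signed_mu_gen (negbTE ji).
- have := PiA_mu_word [:: q] fP.
  by rewrite mu_word_cons /mu_word big_nil mulg1.
exists (q :: l) => k; have [c flc] := fl k.
by exists c; rewrite mu_word_cons mulgA.
Qed.

(** If f * mu_word l sends the letter (i, c) to x k, comparing exponents of
    x i modulo 4 gives delta_ki = 1 or -1 according to c, because no factor
    has both indices equal to i.  Thus k = i and the letter is x i itself. *)
Lemma PI_sub_EPiA : PI n `<=` EPiA n.
Proof.
move=> f [fIA fP]; have [l fl] := PiA_reduction fP.
suff : f * mu_word l = 1.
  move=> fl1; rewrite -[f](mulgK (mu_word l)) fl1 mul1g.
  exact: (is_subgroupV (@EPiA_subgroup n)) (@EPiA_mu_word n l).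
apply: aut_ext => k; have [[i c] flk] := fl k.
have E : exponent4 i ((f * mu_word l) (lift_letter x (i, c))) =
    ((if c then - 1 else 1) *
     ((i == i) + 2 * count (fun q => val q.1 == (i, i)) l)%:R)%R.
  rewrite aut_mulE (IA_exponent4 _ _ fIA) -exponent4_mu_word /lift_letter /=.
  by case: c {flk}; rewrite ?autV ?exponent4V ?GRing.mulN1r ?GRing.mul1r.
have no_diag : count (fun q => val q.1 == (i, i)) l = 0.
  apply/eqP; rewrite -leqn0 leqNgt -has_count; apply/hasPn.
  move=> -[[[a b] /= ab] d] _ /=.
  by apply: contraNN ab => /eqP[-> ->].
move: E; rewrite flk exponent4_gen no_diag eqxx.
case: c flk => flk; last first.
  by case: eqVneq flk => [->|_ _ /(congr1 val)].
by case: (k == i) => /(congr1 val).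
Qed.

End Generation.

Local Close Scope group_scope.

Theorem theorem6p2 (n : nat) (hn : (3 <= n)%N) :
  PI n = IA (freeGroup 'I_n) `&` derived (EPiA n).
Proof.
apply/seteqP; split=> f [fIA].
  by move=> fP; split=> //; apply: IA_EPiA_derived => //; apply: PI_sub_EPiA.
move=> fD; split=> //; apply: EPiA_sub_PiA.
by apply: derived_sub fD; apply: EPiA_subgroup.
Qed.
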